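(* For every integer $K\ge1$ there exist an instance of $(\mathrm{P})$, with arbitrary $A\in\mathbb{Q}^{m\times n}$, $b\in\mathbb{Q}^m$, $c\in\mathbb{Q}_+^n$, and a partition $\mathcal{J}$ of the index set of columns of $A$, such that $G^{\mathrm{pack}}_{A,\mathcal{J}}$ is a star with $K+1$ nodes and $$z^{N.S.}=((K+1)-1)\cdot z^I .$$
   Context: $[n]=\{1,\dots,n\}$. Problem $(\mathrm{P})$ is: maximize $c^Tx$ subject to $Ax\le b$, $x_j\in\mathbb{Z}_+$ for $j\in\mathcal{L}$, $x_j\in\mathbb{R}_+$ for $j\in[n]\setminus\mathcal{L}$, where $\mathcal{L}\subseteq[n]$; here the entries of $A$ and $b$ may have any sign. Let $P$ be its feasible region, $P^I$ the convex hull of $P$, and $P^{LP}$ the feasible region of its linear programming relaxation; $z^I=\max\{c^Tx:x\in P^I\}$. Sparse closures: for $N\subseteq[n]$, a sparse cut on $N$ is an inequality $\alpha^Tx\le\beta$ valid for $P^I$ with $\alpha_i=0$ for all $i\notin N$; $P^{(N)}$ is the set of points of $P^{LP}$ satisfying all sparse cuts on $N$. For a partition $\mathcal{J}=\{J_1,\dots,J_q\}$ of $[n]$, the packing interaction graph $G^{\mathrm{pack}}_{A,\mathcal{J}}$ has one node $v_j$ for each block $J_j$, and distinct nodes $v_i,v_j$ are adjacent iff some row of $A$ has a nonzero entry in a column of $J_i$ and a nonzero entry in a column of $J_j$. A star with $K+1$ nodes is a graph consisting of a center adjacent to $K$ leaves, with no other edges. Natural sparse closure: for each row $i\in[m]$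 let $N_i$ be the union of those blocks $J_u$ for which row $i$ of $A$ has a nonzero entry in some column of $J_u$. Then $P^{N.S.}:=\bigcap_{i=1}^mP^{(N_i)}$ and $z^{N.S.}:=\max\{c^Tx:x\in P^{N.S.}\}$. *)

(* Defs.v *)
From mathcomp Require Import all_boot all_order all_algebra.
From mathcomp Require Import boolp classical_sets reals convex.

Set Implicit Arguments.
Unset Strict Implicit.
Unset Printing Implicit Defensive.

Import Order.TTheory GRing.Theory Num.Theory.

Local Open Scope classical_set_scope.
Local Open Scope ring_scope.

Definition dotv (R : realType) (n : nat) (u x : 'cV[R]_n) : R :=
  (u^T *m x) 0 0.

(* Vectors live in R^n although the data (A, b) is rational. *)
Definition lp_region (R : realType) (m n : nat)
    (A : 'M[rat]_(m, n)) (b : 'cV[rat]_m) : set 'cV[R]_n :=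
  [set x | (forall i, (map_mx ratr A *m x) i 0 <= ratr (b i 0)) /\
           (forall j, 0 <= x j 0)].

Definition mip_region (R : realType) (m n : nat)
    (A : 'M[rat]_(m, n)) (b : 'cV[rat]_m) (L : {set 'I_n}) : set 'cV[R]_n :=
  [set x | lp_region A b x /\ (forall j, j \in L -> x j 0 \is a Num.nat)].

Definition convex_hull (R : realType) (n : nat) (S : set 'cV[R]_n) :
    set 'cV[R]_n :=
  smallest (@convex_set R 'cV[R]_n) S.

Definition mip_hull (R : realType) (m n : nat)
    (A : 'M[rat]_(m, n)) (b : 'cV[rat]_m) (L : {set 'I_n}) : set 'cV[R]_n :=
  convex_hull (mip_region A b L).

Definition sparse_cut (R : realType) (m n : nat)
    (A : 'M[rat]_(m, n)) (b : 'cV[rat]_m) (L N : {set 'I_n})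
    (alpha : 'cV[R]_n) (beta : R) : Prop :=
  (forall i, i \notin N -> alpha i 0 = 0) /\
  (forall x, mip_hull A b L x -> dotv alpha x <= beta).

Definition sparse_closure (R : realType) (m n : nat)
    (A : 'M[rat]_(m, n)) (b : 'cV[rat]_m) (L N : {set 'I_n}) : set 'cV[R]_n :=
  [set x | lp_region A b x /\
           (forall alpha beta, sparse_cut A b L N alpha beta ->
              dotv alpha x <= beta)].

Definition row_meets (m n : nat) (A : 'M[rat]_(m, n)) (i : 'I_m)
    (B : {set 'I_n}) : bool :=
  [exists j in B, A i j != 0].

Definition row_blocks (m n : nat) (A : 'M[rat]_(m, n))
    (J : {set {set 'I_n}}) (i : 'I_m) : {set 'I_n} :=
  (\bigcup_(B in J | row_meets A i B) B)%SET.

Definition natural_sparse_closure (R : realType) (m n : nat)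
    (A : 'M[rat]_(m, n)) (b : 'cV[rat]_m) (L : {set 'I_n})
    (J : {set {set 'I_n}}) : set 'cV[R]_n :=
  \bigcap_(i in [set: 'I_m]) sparse_closure A b L (row_blocks A J i).

(* The packing interaction graph has the blocks of the partition J themselves
   as nodes; this is its edge relation. *)
Definition pack_adj (m n : nat) (A : 'M[rat]_(m, n)) : rel {set 'I_n} :=
  fun B C => (B != C) && [exists i, row_meets A i B && row_meets A i C].

Definition is_star (T : finType) (V : {set T}) (e : rel T) (k : nat) : Prop :=
  #|V| = k.+1 /\
  exists2 v, v \in V &
    {in V &, forall u w, e u w = (u != w) && ((u == v) || (w == v))}.

Definition is_max_over (R : realType) (n : nat) (c : 'cV[rat]_n)
    (S : set 'cV[R]_n) (z : R) : Prop :=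
  let values := [set dotv (map_mx ratr c) x | x in S] in
  values z /\ ubound values z.

(* Main.v *)
(** With center variables [y = (y_0, y_1)] and one variable [w_i] per leaf, the
    rows say [|y_0 - (2i+1) y_1 - (K - i)| <= K (1 - w_i)], all variables being
    integers.  So [w_i <= 1], and [w_i = 1] forces [y] onto a line [l_i].  The
    lines [l_i] pairwise meet only at the non-integral point [(K + 1/2, 1/2)],
    hence no two [w_i] equal [1] at an integral point, and [z^I = 1].  But each
    [l_i] has two integral points with midpoint [(K + 1/2, 1/2)], so no cut seeing
    only [y] and a single [w_i] removes [y = (K + 1/2, 1/2)], [w = (1, ..., 1)],
    and [z^{N.S.} = K]. *)
Require Import Defs.
From mathcomp Require Import all_boot all_order all_algebra.
From mathcomp Require Import boolp classical_sets reals convex.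
From mathcomp Require Import interval_inference ring lra zify.

Import Order.TTheory GRing.Theory Num.Theory.

Local Open Scope ring_scope.

(** * Linear bounds over the convex hull *)

Lemma mem_mip_hull (R : realType) (m n : nat) (A : 'M[rat]_(m, n))
    (b : 'cV[rat]_m) (L : {set 'I_n}) (x : 'cV[R]_n) :
  mip_region A b L x -> mip_hull A b L x.
Proof. by move=> xP C [_]; apply. Qed.

Lemma dotvE (R : realType) (n : nat) (u x : 'cV[R]_n) :
  dotv u x = \sum_j u j 0 * x j 0.
Proof. by rewrite /dotv mxE; apply: eq_bigr => j _; rewrite mxE. Qed.

(** A half-space is convex, so it is one of the convex sets whose intersection is the hull. *)
Lemma mip_hull_dotv_le (R : realType) (m n : nat) (A : 'M[rat]_(m, n))
    (b : 'cV[rat]_m) (L : {set 'I_n}) (c : 'cV[R]_n) (z : R) :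
  (forall x, mip_region A b L x -> dotv c x <= z) ->
  forall x, mip_hull A b L x -> dotv c x <= z.
Proof.
move=> le_z x hx; apply: (hx [set x | dotv c x <= z]%classic); split=> //=.
apply/convex_setW => u v; rewrite !inE /= => uz vz t t0 t1.
(* The abstract combination of the convex structure is exposed as a vector expression, so that
   linearity of [dotv] applies. *)
rewrite inE /= [X in dotv c X](_ : _ = t%:num *: (u : 'cV_n) + (1 - t%:num) *: v) //.
have -> : dotv c (t%:num *: (u : 'cV_n) + (1 - t%:num) *: v)
          = t%:num * dotv c u + (1 - t%:num) * dotv c v.
  by rewrite /dotv mulmxDr -!scalemxAr mxE; congr (_ + _); rewrite mxE.
nra.
Qed.

(** * The instance and its interaction graph *)

Section StarInstance.
Variable K : nat.

Definition center_mx : 'M[rat]_(K, 2) :=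
  \matrix_(i, j) if j == 0 then 1 else - (2 * i + 1)%:R.

Definition star_mx : 'M[rat]_(K + K, 2 + K) :=
  block_mx center_mx K%:R%:M (- center_mx) K%:R%:M.

(** With slack $K$ around the offset $K - i$, the two sides of the absolute value give $K + (K - i)$
    and $K - (K - i) = i$. *)
Definition star_rhs : 'cV[rat]_(K + K) :=
  col_mx (\col_i (K%:R + (K%:R - i%:R))) (\col_i i%:R).

Definition star_obj : 'cV[rat]_(2 + K) := col_mx 0 (const_mx 1).

(** [None] stands for the center of the star and [Some i] for leaf [i]. *)
Definition node_of (j : 'I_(2 + K)) : option 'I_K :=
  if split j is inr i then Some i else None.

Definition leaf_of_row (r : 'I_(K + K)) : 'I_K :=
  match split r with inl i => i | inr i => i end.

Definition node_block (o : option 'I_K) : {set 'I_(2 + K)} :=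
  [set j | node_of j == o].

Definition star_blocks : {set {set 'I_(2 + K)}} :=
  [set node_block o | o : option 'I_K].

Lemma node_of_l j : node_of (lshift K j) = None.
Proof. by rewrite /node_of (unsplitK (inl _ j)). Qed.

Lemma node_of_r i : node_of (rshift 2 i) = Some i.
Proof. by rewrite /node_of (unsplitK (inr _ i)). Qed.

Lemma leaf_of_row_l i : leaf_of_row (lshift K i) = i.
Proof. by rewrite /leaf_of_row (unsplitK (inl _ i)). Qed.

Lemma leaf_of_row_r i : leaf_of_row (rshift K i) = i.
Proof. by rewrite /leaf_of_row (unsplitK (inr _ i)). Qed.

Lemma node_of_surj o : exists j, node_of j = o.
Proof.
by case: o => [i|]; [exists (rshift 2 i); rewrite node_of_r
                    | exists (lshift K 0); rewrite node_of_l].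
Qed.

Lemma node_block_inj : injective node_block.
Proof.
move=> o o' eq_oo'; have [j jo] := node_of_surj o.
by move/setP/(_ j): eq_oo'; rewrite !inE jo eqxx => /esym/eqP.
Qed.

Lemma star_blocks_partition : finset.partition star_blocks [set: 'I_(2 + K)].
Proof.
apply/and3P; split.
- rewrite finset.eqEsubset finset.subsetT; apply/fintype.subsetP => j _.
  by apply/finset.bigcupP; exists (node_block (node_of j)); rewrite ?imset_f ?inE.
- apply/finset.trivIsetP => _ _ /imsetP[o _ ->] /imsetP[o' _ ->] neq.
  rewrite -finset.setI_eq0; apply/eqP/setP => j; rewrite !inE.
  by apply/negP => /andP[/eqP -> /eqP eqo]; rewrite eqo eqxx in neq.
- apply/imsetP => -[o _ /setP]; have [j jo] := node_of_surj o.
  by move=> /(_ j); rewrite !inE jo eqxx.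
Qed.

(** The center coefficients $\pm 1$ and $\pm(2i+1)$ never vanish, and the leaf part of each half is
    the diagonal matrix $K I$ with $K > 0$. *)
Lemma star_mx_neq0 r j : (0 < K)%N ->
  (star_mx r j != 0) = (node_of j \in [:: None; Some (leaf_of_row r)]).
Proof.
move=> K0; have Kn0 : K%:R != 0 :> rat by rewrite pnatr_eq0 -lt0n.
have c0 i (k : 'I_2) : center_mx i k != 0.
  by rewrite mxE; case: ifP => // _; rewrite oppr_eq0 pnatr_eq0 addn1.
case: (split_ordP r) => i ->; case: (split_ordP j) => k ->;
  rewrite /star_mx ?block_mxEul ?block_mxEur ?block_mxEdl ?block_mxEdr;
  rewrite ?node_of_l ?node_of_r ?leaf_of_row_l ?leaf_of_row_r !inE /=.
- by rewrite c0.
- by rewrite mxE (inj_eq Some_inj) (eq_sym i) mulrn_eq0 negb_or Kn0 andbT eqb0 negbK.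
- by rewrite mxE oppr_eq0 c0.
- by rewrite mxE (inj_eq Some_inj) (eq_sym i) mulrn_eq0 negb_or Kn0 andbT eqb0 negbK.
Qed.

Lemma row_meets_node_block r o : (0 < K)%N ->
  row_meets star_mx r (node_block o) = (o \in [:: None; Some (leaf_of_row r)]).
Proof.
move=> K0; apply/existsP/idP => [[j] | oin].
  by rewrite inE star_mx_neq0 // => /andP[/eqP <-].
have [j jo] := node_of_surj o; exists j.
by rewrite inE star_mx_neq0 // jo eqxx.
Qed.

Lemma star_blocks_is_star : (0 < K)%N -> is_star star_blocks (pack_adj star_mx) K.
Proof.
move=> K0; split.
  by rewrite (card_imset _ node_block_inj) card_option card_ord.
exists (node_block None); first exact: imset_f.
move=> _ _ /imsetP[o _ ->] /imsetP[o' _ ->].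
rewrite /pack_adj !(inj_eq node_block_inj).
have [//|/= oo'] := eqVneq o o'.
apply/existsP/idP => [[r] | ].
  (* A row meets only the center and one leaf, so two distinct blocks in a common row cannot both be
     leaves. *)
  rewrite !row_meets_node_block // !inE.
  case: eqP => //= _ /andP[/eqP eqo]; case: eqP => //= _ /eqP eqo'.
  by rewrite eqo eqo' eqxx in oo'.
(* A row of the non-central block joins it to the center. The default only makes [r] total: it is
   taken at [None], which every row meets. *)
pose r (o : option 'I_K) : 'I_(K + K) := lshift K (odflt (Ordinal K0) o).
case/orP => /eqP eqN; rewrite eqN; [exists (r o') | exists (r o)];
  rewrite !row_meets_node_block // !inE leaf_of_row_l eqxx ?andbT /=.
- by case: (o') => //= ?; rewrite eqxx.
- by case: (o) => //= ?; rewrite eqxx.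
Qed.

Lemma row_blocks_star r j : (0 < K)%N ->
  (j \in row_blocks star_mx star_blocks r) =
  (node_of j \in [:: None; Some (leaf_of_row r)]).
Proof.
move=> K0; apply/finset.bigcupP/idP => [[_ /andP[/imsetP[o _ ->]]] | jr].
  by rewrite row_meets_node_block // => om; rewrite inE => /eqP ->.
exists (node_block (node_of j)); last by rewrite inE.
by rewrite row_meets_node_block // jr andbT; apply: imset_f.
Qed.

(** * Feasible points, the integral bound and the sparse closure *)

Section Region.
Variable R : realType.
Implicit Types (y : 'cV[R]_2) (w : 'cV[R]_K).

(** Rows [lshift K i] and [rshift K i] are the two one-sided bounds that make up the absolute value
    for leaf [i]. *)
Lemma star_lp_regionP y w :
  lp_region star_mx star_rhs (col_mx y w) <->
  [/\ forall i : 'I_K, `|y 0 0 - (2 * i + 1)%:R * y 1 0 - (K%:R - i%:R)|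
                  <= K%:R * (1 - w i 0),
      forall j, 0 <= y j 0 & forall i, 0 <= w i 0].
Proof.
have Cy (i : 'I_K) : (map_mx ratr center_mx *m y) i 0
            = y 0 0 - (2 * i + 1)%:R * y 1 0.
  by rewrite mxE !big_ord_recl big_ord0 !mxE /= rmorph1 rmorphN /= ratr_nat;
     rewrite mul1r addr0 mulNr; congr (_ - _ * y _ _); apply: val_inj.
have Kw i : (map_mx ratr (K%:R%:M : 'M[rat]_K) *m w) i 0 = K%:R * w i 0.
  by rewrite map_scalar_mx mul_scalar_mx mxE /= ratr_nat.
have rowl (i : 'I_K) : (map_mx ratr star_mx *m col_mx y w) (lshift K i) 0
    = y 0 0 - (2 * i + 1)%:R * y 1 0 + K%:R * w i 0.
  by rewrite map_block_mx mul_block_col col_mxEu mxE Cy Kw.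
have rowr (i : 'I_K) : (map_mx ratr star_mx *m col_mx y w) (rshift K i) 0
    = - (y 0 0 - (2 * i + 1)%:R * y 1 0) + K%:R * w i 0.
  by rewrite map_block_mx mul_block_col col_mxEd mxE map_mxN mulNmx mxE Cy Kw.
have bl (i : 'I_K) : ratr (star_rhs (lshift K i) 0) = K%:R + (K%:R - i%:R) :> R.
  by rewrite col_mxEu mxE rmorphD rmorphB /= !ratr_nat.
have br (i : 'I_K) : ratr (star_rhs (rshift K i) 0) = i%:R :> R.
  by rewrite col_mxEd mxE ratr_nat.
split=> [[Axb x0]|[Hw y0 w0]].
  split=> [i|j|i].
  - have := Axb (lshift K i); have := Axb (rshift K i).
    rewrite rowl rowr bl br ler_norml => H1 H2; apply/andP; split; lra.
  - by have := x0 (lshift K j); rewrite col_mxEu.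
  - by have := x0 (rshift 2 i); rewrite col_mxEd.
split=> r; case: (split_ordP r) => i ->.
- by have := Hw i; rewrite rowl bl ler_norml => /andP[? ?]; lra.
- by have := Hw i; rewrite rowr br ler_norml => /andP[? ?]; lra.
- by rewrite col_mxEu.
- by rewrite col_mxEd.
Qed.

Lemma dotv_star_obj y w :
  dotv (map_mx ratr star_obj) (col_mx y w) = \sum_i w i 0.
Proof.
rewrite dotvE big_split_ord /= big1 ?add0r => [|j _]; last first.
  by rewrite mxE /star_obj !col_mxEu mxE rmorph0 mul0r.
by apply: eq_bigr => i _; rewrite mxE /star_obj !col_mxEd mxE rmorph1 mul1r.
Qed.

Lemma star_mip_le1 (x : 'cV[R]_(2 + K)) : (0 < K)%N ->
  mip_region star_mx star_rhs [set: _] x ->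
  dotv (map_mx ratr star_obj) x <= 1.
Proof.
move=> K0; rewrite -(vsubmxK x); set y := usubmx x; set w := dsubmx x.
case=> /star_lp_regionP[yw y0 w0] xN.
have KR0 : 0 < K%:R :> R by rewrite ltr0n.
have wN i : w i 0 \is a Num.nat.
  by have := xN (rshift 2 i); rewrite col_mxEd; apply.
have /natrP[q yq] : y 1 0 \is a Num.nat.
  by have := xN (lshift K 1); rewrite col_mxEu; apply.
(* The slack $K(1 - w_i)$ dominates an absolute value, hence is nonnegative. *)
have w1 i : w i 0 <= 1.
  by rewrite -subr_ge0 -(pmulr_rge0 _ KR0); apply: le_trans (yw i).
have on_line (i : 'I_K) : w i 0 != 0 ->
    w i 0 = 1 /\ y 0 0 = (2 * i + 1)%:R * y 1 0 + (K%:R - i%:R).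
  have /natrP[k wk] := wN i; have := w1 i; rewrite wk lern1 pnatr_eq0.
  case: k wk => [|[]] // wk _ _; split=> //.
  have := yw i; rewrite wk subrr mulr0 normr_le0 => /eqP; lra.
rewrite dotv_star_obj; have [/existsP[i wi]|] := boolP [exists i, w i 0 != 0].
  have [wi1 yi] := on_line i wi.
  rewrite (bigD1 i) //= big1 ?addr0 ?wi1 // => j ji.
  apply/eqP; apply: contraT => /on_line[_]; rewrite yi yq.
  (* Equating the two lines at $y_1 = q$ gives $(i - j)(2q - 1) = 0$, and $2q = 1$ fails by
     parity. *)
  move=> eq_ij; have /eqP : (i%:R - j%:R) * ((2 * q)%:R - 1) = 0 :> R.
    by move: eq_ij; rewrite !natrD; lra.
  rewrite mulf_eq0 !subr_eq0 eqr_nat (eqr_nat R _ 1).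
  by case/orP => [/eqP/ord_inj eqij|]; [rewrite eqij eqxx in ji | lia].
rewrite negb_exists => /forallP w_eq0.
by rewrite big1 // => i _; have := w_eq0 i; rewrite negbK => /eqP.
Qed.

(** The line $l_i$ parametrized by $t = y_1$: it is integral at $t = 0$ and $t = 1$, and $t = 1/2$
    is the point common to all lines. *)
Definition line_pt (i : 'I_K) (t : R) : 'cV[R]_2 :=
  \col_k if k == 0 then K%:R - i%:R + (2 * i + 1)%:R * t else t.

Lemma line_pt_half i j : line_pt i 2^-1 = line_pt j 2^-1.
Proof.
apply/colP => k; rewrite !mxE; case: ifP => // _.
by rewrite !natrD; field.
Qed.

(** On $l_i$, the expression bounded by the rows of leaf $k$ simplifies to $(k - i)(1 - 2t)$. *)
Lemma star_lp_line (i : 'I_K) (t : R) w :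
  (forall k : 'I_K, `|(k%:R - i%:R) * (1 - 2 * t)| <= K%:R * (1 - w k 0)) ->
  0 <= t -> (forall k, 0 <= w k 0) ->
  lp_region star_mx star_rhs (col_mx (line_pt i t) w).
Proof.
move=> tw t0 w0; apply/star_lp_regionP; split=> // [k | j].
  rewrite [X in `|X|](_ : _ = (k%:R - i%:R) * (1 - 2 * t)) //.
  by rewrite !mxE /= !natrD; ring.
rewrite mxE; case: ifP => // _.
by rewrite addr_ge0 ?mulr_ge0 // subr_ge0 ler_nat ltnW.
Qed.

(** At $t \in \{0, 1\}$ the deviation from $l_k$ is $|k - i| < K$, which the slack $K$ absorbs when
    $w_k = 0$; for $k = i$ it is zero. *)
Lemma star_mip_line i (t : bool) :
  mip_region star_mx star_rhs [set: _]
    (col_mx (line_pt i t%:R) (delta_mx i 0)).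
Proof.
split=> [|j _].
  apply: star_lp_line => // k; last by rewrite mxE.
  rewrite mxE eqxx andbT; have [->|ki] := eqVneq k i.
    by rewrite !subrr mul0r normr0 mulr0.
  rewrite subr0 mulr1 normrM.
  have -> : `|1 - 2 * t%:R| = 1 :> R.
    by case: t; rewrite ?mulr0 ?mulr1 ?subr0 ?normr1 // -normrN opprB;
       rewrite (_ : 2 - 1 = 1) ?normr1 //; lra.
  rewrite mulr1 ler_norml; have := ltn_ord k; have := ltn_ord i.
  rewrite -!(ltr_nat R) => ? ?; have := ler0n R i; have := ler0n R k.
  by move=> ? ?; apply/andP; split; lra.
case: (split_ordP j) => k ->; rewrite ?col_mxEu ?col_mxEd mxE ?natr_nat //.
case: ifP => _; rewrite ?natr_nat //.
(* Since $i < K$, the difference $K - i$ is a genuine natural number. *)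
by rewrite -natrB ?(ltnW (ltn_ord i)) // -natrM -natrD natr_nat.
Qed.

Lemma ones_mem_star_closure i : (0 < K)%N ->
  natural_sparse_closure star_mx star_rhs [set: _] star_blocks
    (col_mx (line_pt i 2^-1) (const_mx 1)).
Proof.
move=> K0 r _; split.
  apply: star_lp_line => [k||k]; last by rewrite mxE.
    by rewrite mulfV ?subrr ?mulr0 ?normr0 ?mxE ?subrr ?mulr0 // pnatr_eq0.
  by rewrite invr_ge0.
move=> alpha beta [alpha0 cut]; set l := leaf_of_row r.
(* The two integral points of $l_l$, with only leaf [l] switched on. *)
pose p (t : bool) := col_mx (line_pt l t%:R) (delta_mx l 0).
have cut_p t : dotv alpha (p t) <= beta
  by apply: cut; apply: mem_mip_hull; apply: star_mip_line.
(* The midpoint of [p false] and [p true] agrees with the target on the center and on leaf [l]. It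
   differs only at other leaves, where [alpha] vanishes. *)
suff -> : dotv alpha (col_mx (line_pt i 2^-1) (const_mx 1))
          = (dotv alpha (p false) + dotv alpha (p true)) / 2.
  by have := cut_p false; have := cut_p true; lra.
rewrite !dotvE -big_split mulr_suml /=; apply: eq_bigr => j _.
have [|j_notin] := boolP (j \in row_blocks star_mx star_blocks r); last first.
  by rewrite alpha0 // !mul0r addr0 mul0r.
rewrite (line_pt_half i l) row_blocks_star //.
rewrite /p; case: (split_ordP j) => k ->.
  by rewrite !col_mxEu !mxE => _; case: ifP => _ /=; rewrite ?natrD; field.
rewrite node_of_r !inE /= !col_mxEd !mxE => /eqP[->].
by rewrite !eqxx /=; field.
Qed.

End Region.
End StarInstance.

Theorem theorem30 (R : realType) (K : nat) (hK : (1 <= K)%N) :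
  exists (m n : nat) (A : 'M[rat]_(m, n)) (b : 'cV[rat]_m) (c : 'cV[rat]_n)
         (L : {set 'I_n}) (J : {set {set 'I_n}}) (zI zNS : R),
    (forall j, 0 <= c j 0) /\
    finset.partition J [set: 'I_n]%SET /\
    is_star J (pack_adj A) K /\
    is_max_over c (mip_hull A b L) zI /\
    is_max_over c (natural_sparse_closure A b L J) zNS /\
    0 < zI /\
    zNS = ((K + 1)%:R - 1) * zI.
Proof.
exists (K + K)%N, (2 + K)%N, (star_mx K), (star_rhs K), (star_obj K).
exists [set: _]%SET, (star_blocks K), 1, K%:R.
pose i0 := Ordinal hK.
split; first by move=> j; case: (split_ordP j) => k ->;
  rewrite ?col_mxEu ?col_mxEd mxE.
split; first exact: star_blocks_partition.
split; first exact: star_blocks_is_star.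
split.
  split=> [|_ [x /mip_hull_dotv_le + <-]]; last first.
    by apply=> u; apply: star_mip_le1.
  (* The value 1 is attained with a single leaf on, at the integral point $t = 0$ of its line. *)
  exists (col_mx (line_pt K R i0 0) (delta_mx i0 0)).
    by apply: mem_mip_hull; apply: (star_mip_line K R i0 false).
  rewrite dotv_star_obj (bigD1 i0) //= big1 => [|i /negPf neq].
    by rewrite addr0 mxE !eqxx.
  by rewrite mxE neq.
split; last by rewrite natrD addrK mulr1.
split=> [|_ [x xNS <-]].
  exists (col_mx (line_pt K R i0 2^-1) (const_mx 1)).
    exact: ones_mem_star_closure.
  rewrite dotv_star_obj (eq_bigr (fun=> 1)) => [|i _]; last by rewrite mxE.
  by rewrite sumr_const card_ord.
(* The upper bound comes from the relaxation alone, where each $w_i \le 1$; any row gives membership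
   in it, and $K \ge 1$ provides one. *)
have [+ _] := xNS (lshift K i0) I.
rewrite -(vsubmxK x) dotv_star_obj => /star_lp_regionP[yw _ _].
(* $K$ is written as a sum of $K$ ones to compare termwise. *)
rewrite -[leRHS]/(1 *+ K) -[in leRHS](card_ord K) -sumr_const.
apply: ler_sum => i _; rewrite -subr_ge0.
have KR0 : 0 < K%:R :> R by rewrite ltr0n.
by rewrite -(pmulr_rge0 _ KR0); apply: le_trans (yw i).
Qed.
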